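(* Fix a measurable $f:\Omega\to[0,\infty]$ and define $f\circ\sigma$ by $(f\circ\sigma)(\omega)=f(\sigma(\omega))$. Then for all $s,t\in X_{f\circ\sigma}$, $$(LJ_f)(s,t)=J_{f\circ\sigma}(s,t).$$ In particular, if $f=f\circ\sigma$ $\mu$-almost surely, then $J_f$ is $L$-invariant on $X_f$, i.e. $(LJ_f)(s,t)=J_f(s,t)$ for all $s,t\in X_f$.
   Context: Let $X$ be a set, $m\ge1$ an integer, and $\varphi_1,\dots,\varphi_m:X\to X$ maps. A kernel $J:Y\times Y\to\mathbb{C}$ is positive definite if $\sum_{\alpha,\beta}\overline{c_\alpha}c_\beta J(s_\alpha,s_\beta)\ge0$ for all finite families $(c_\alpha,s_\alpha)\in\mathbb{C}\times Y$; $J_1\le J_2$ means that $J_2-J_1$ is positive definite. The pullback operator is $(LJ)(s,t):=\sum_{i=1}^m J(\varphi_i(s),\varphi_i(t))$. Fix a positive definite kernel $K$ on $X$ with $LK\ge K$. Set $K_0:=K$, $K_{n+1}:=LK_n$, $u_n(s):=K_n(s,s)$ (nondecreasing in $n$), $u_\infty(s):=\lim_nu_n(s)\in[0,\infty]$, $X_{\mathrm{fin}}:=\{s\in X:u_\infty(s)<\infty\}$. Each $\varphi_i$ maps $X_{\mathrm{fin}}$ into itself. For $s,t\in X_{\mathrm{fin}}$ the limit $K_\infty(s,t):=\lim_nK_n(s,t)$ exists; $K_\infty$ is positive definite on $X_{\mathrm{fin}}$ and $LK_\infty=K_\infty$ there; $K_\infty(s,s)=u_\infty(s)$. Words: $W_n:=\{1,\dots,m\}^n$,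 $W_0=\{\emptyset\}$; for $w=i_1\cdots i_n\in W_n$, $\varphi_w:=\varphi_{i_n}\circ\cdots\circ\varphi_{i_1}$ ($\varphi_\emptyset=\mathrm{id}$). $\Omega:=\{1,\dots,m\}^{\mathbb{N}}$ with product $\sigma$-algebra and product probability measure $\mu$ making the coordinates independent and uniform on $\{1,\dots,m\}$. For $\omega=\omega_1\omega_2\cdots\in\Omega$, $\omega|n:=\omega_1\cdots\omega_n\in W_n$ ($\omega|0=\emptyset$); $\sigma:\Omega\to\Omega$ is the left shift $\sigma(\omega_1\omega_2\cdots)=\omega_2\omega_3\cdots$. For $s,t\in X_{\mathrm{fin}}$, $M_n(s,t;\omega):=m^nK_\infty(\varphi_{\omega|n}(s),\varphi_{\omega|n}(t))$. For $s\in X_{\mathrm{fin}}$ let $B(s):=\sup_{n\ge0}\{m^n\sum_{w\in W_n}u_\infty(\varphi_w(s))^2\}\in[0,\infty]$, and $X_2:=\{s\in X_{\mathrm{fin}}:B(s)<\infty\}$; each $\varphi_k$ maps $X_2$ into itself. For $s,t\in X_2$, $M_n(s,t;\cdot)$ converges in $L^2(\Omega,\mu)$ and $\mu$-almost surely; $M_\infty(s,t;\cdot)\in L^2(\Omega,\mu)$ denotes (a fixed measurable version of) the limit, with $M_\infty(s,s;\cdot)\ge0$; $h(s;\omega):=M_\infty(s,s;\omega)\in[0,\infty)$. For measurable $f:\Omega\to[0,\infty]$ let $X_f:=\{s\in X_2:\int_\Omega f(\omega)h(s;\omega)\,d\mu(\omega)<\infty\}$ and, for $s,t\in X_f$, $J_f(s,t):=\int_\Omega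 f(\omega)M_\infty(s,t;\omega)\,d\mu(\omega)$, with the convention $\infty\cdot0=0$; this integral converges absolutely for $s,t\in X_f$. For $s\in X_{f\circ\sigma}$ one has $\varphi_i(s)\in X_f$ for every $i$, so $(LJ_f)(s,t)=\sum_{i=1}^mJ_f(\varphi_i(s),\varphi_i(t))$ is defined for $s,t\in X_{f\circ\sigma}$. *)

(* Defs.v *)
From HB Require Import structures.
From mathcomp Require Import all_boot all_order all_algebra.
From mathcomp Require Import all_classical all_reals all_analysis.
From mathcomp Require Import measurable_realfun complex.

Set Implicit Arguments.
Unset Strict Implicit.
Unset Printing Implicit Defensive.

Import Order.TTheory GRing.Theory Num.Theory.
Import numFieldNormedType.Exports.
Local Open Scope classical_set_scope.
Local Open Scope ring_scope.

(* Throughout, the number m >= 1 of maps is written p.+1, and the alphabet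
   {1, ..., m} is 'I_p.+1. *)

Definition posdef (R : realType) (Y : Type) (J : Y -> Y -> R[i]) : Prop :=
  forall (n : nat) (c : 'I_n -> R[i]) (s : 'I_n -> Y),
    0 <= \sum_(a < n) \sum_(b < n) (c a)^* * c b * J (s a) (s b).

Definition kernel_le (R : realType) (Y : Type) (J1 J2 : Y -> Y -> R[i]) : Prop :=
  posdef (fun s t => J2 s t - J1 s t).

Definition pullback (R : realType) (X : Type) (p : nat)
    (phi : 'I_p.+1 -> X -> X) (J : X -> X -> R[i]) : X -> X -> R[i] :=
  fun s t => \sum_(i < p.+1) J (phi i s) (phi i t).

Definition Kn (R : realType) (X : Type) (p : nat) (phi : 'I_p.+1 -> X -> X)
    (K : X -> X -> R[i]) (n : nat) : X -> X -> R[i] :=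
  iter n (pullback phi) K.

(* Re is harmless here: the diagonal of a positive definite kernel is real. *)
Definition un (R : realType) (X : Type) (p : nat) (phi : 'I_p.+1 -> X -> X)
    (K : X -> X -> R[i]) (n : nat) (s : X) : R :=
  complex.Re (Kn phi K n s s).

Definition uinf (R : realType) (X : Type) (p : nat) (phi : 'I_p.+1 -> X -> X)
    (K : X -> X -> R[i]) (s : X) : \bar R :=
  limn (fun n => (un phi K n s)%:E).

Definition Xfin (R : realType) (X : Type) (p : nat) (phi : 'I_p.+1 -> X -> X)
    (K : X -> X -> R[i]) : set X :=
  [set s | (uinf phi K s < +oo)%E].

(* Limits in R[i] are taken on real and imaginary parts. Kinf is only
   meaningful on Xfin, where the limits exist. *)
Definition Kinf (R : realType) (X : Type) (p : nat) (phi : 'I_p.+1 -> X -> X)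
    (K : X -> X -> R[i]) (s t : X) : R[i] :=
  Complex (limn (fun n => complex.Re (Kn phi K n s t)))
          (limn (fun n => complex.Im (Kn phi K n s t))).

Definition cvg_complex (R : realType) (z : nat -> R[i]) (l : R[i]) : Prop :=
  (fun n => complex.Re (z n)) @ \oo --> complex.Re l /\
  (fun n => complex.Im (z n)) @ \oo --> complex.Im l.

(* phi_w = phi_(i_n) \o ... \o phi_(i_1) for w = i_1 ... i_n: the first letter
   is applied first. *)
Definition phiw (X : Type) (p : nat) (phi : 'I_p.+1 -> X -> X)
    (w : seq 'I_p.+1) (s : X) : X :=
  foldl (fun x i => phi i x) s w.

HB.instance Definition _ (p : nat) := isPointed.Build 'I_p.+1 ord0.

Definition coord_events (p : nat) : set (set (nat -> 'I_p.+1)) :=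
  [set A | exists (k : nat) (i : 'I_p.+1), A = [set w | w k = i]].

(* The product sigma-algebra is generated by the coordinate events; the letter
   omega_(k+1) is [w k]. *)
Notation Omega p := (g_sigma_algebraType (@coord_events p)).

(* The coordinates are independent and uniform; this determines [mu]. *)
Definition iid_uniform (R : realType) (p : nat)
    (mu : probability (Omega p) R) : Prop :=
  (forall (k : nat) (i : 'I_p.+1),
     mu [set w : Omega p | w k = i] = (p.+1%:R^-1)%:E) /\
  (forall (N : seq nat) (A : nat -> set 'I_p.+1), uniq N ->
     mu (\bigcap_(k in [set` N]) [set w : Omega p | A k (w k)]) =
     (\prod_(k <- N) mu [set w : Omega p | A k (w k)])%E).

Definition wprefix (p : nat) (w : Omega p) (n : nat) : seq 'I_p.+1 := mkseq w n.

Definition left_shift (p : nat) (w : Omega p) : Omega p := fun k => w k.+1.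

Definition Mn (R : realType) (X : Type) (p : nat) (phi : 'I_p.+1 -> X -> X)
    (K : X -> X -> R[i]) (n : nat) (s t : X) (w : Omega p) : R[i] :=
  p.+1%:R ^+ n * Kinf phi K (phiw phi (wprefix w n) s) (phiw phi (wprefix w n) t).

Definition Bsup (R : realType) (X : Type) (p : nat) (phi : 'I_p.+1 -> X -> X)
    (K : X -> X -> R[i]) (s : X) : \bar R :=
  ereal_sup (range (fun n : nat =>
    ((p.+1%:R ^+ n)%:E *
     \sum_(w : n.-tuple 'I_p.+1) (uinf phi K (phiw phi w s)) ^+ 2)%E)).

Definition X2 (R : realType) (X : Type) (p : nat) (phi : 'I_p.+1 -> X -> X)
    (K : X -> X -> R[i]) : set X :=
  [set s | Xfin phi K s /\ (Bsup phi K s < +oo)%E].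

(* [Minf] is a choice, for all s, t in X2, of a measurable square-integrable
   version of the L^2 and almost sure limit of the M_n(s,t), nonnegative for
   s = t (0 <= z in R[i] entails that z is real). *)
Definition is_limit_version (R : realType) (X : Type) (p : nat)
    (phi : 'I_p.+1 -> X -> X) (K : X -> X -> R[i])
    (mu : probability (Omega p) R) (Minf : X -> X -> Omega p -> R[i]) : Prop :=
  (forall s t : X, X2 phi K s -> X2 phi K t ->
    [/\ measurable_fun setT (fun w => complex.Re (Minf s t w)),
        measurable_fun setT (fun w => complex.Im (Minf s t w)),
        (\int[mu]_w (Normc.normc (Minf s t w) ^+ 2)%:E < +oo)%E,
        (fun n => \int[mu]_w
           (Normc.normc (Mn phi K n s t w - Minf s t w) ^+ 2)%:E)%E
          @ \oo --> 0%E &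
        {ae mu, forall w, cvg_complex (fun n => Mn phi K n s t w) (Minf s t w)}])
  /\ (forall (s : X) (w : Omega p), X2 phi K s -> 0 <= Minf s s w).

Definition hdiag (R : realType) (X : Type) (p : nat)
    (Minf : X -> X -> Omega p -> R[i]) (s : X) (w : Omega p) : R :=
  complex.Re (Minf s s w).

(* Multiplication in \bar R satisfies +oo * 0 = 0. *)
Definition Xf (R : realType) (X : Type) (p : nat) (phi : 'I_p.+1 -> X -> X)
    (K : X -> X -> R[i]) (mu : probability (Omega p) R)
    (Minf : X -> X -> Omega p -> R[i]) (f : Omega p -> \bar R) : set X :=
  [set s | X2 phi K s /\ (\int[mu]_w (f w * (hdiag Minf s w)%:E) < +oo)%E].

(* The integral of the complex function f * Minf s t, by real and imaginary
   parts; it converges absolutely for s, t in Xf, and [fine] is then harmless. *)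
Definition Jf (R : realType) (X : Type) (p : nat)
    (mu : probability (Omega p) R)
    (Minf : X -> X -> Omega p -> R[i]) (f : Omega p -> \bar R)
    (s t : X) : R[i] :=
  Complex (fine (\int[mu]_w (f w * (complex.Re (Minf s t w))%:E))%E)
          (fine (\int[mu]_w (f w * (complex.Im (Minf s t w))%:E))%E).

(* Main.v *)
Require Import Defs.
From mathcomp Require Import all_boot all_order all_algebra.
From mathcomp Require Import all_classical all_reals all_analysis.
From mathcomp Require Import measurable_realfun complex.
From mathcomp Require Import lra.

Set Implicit Arguments.
Unset Strict Implicit.
Unset Printing Implicit Defensive.

Import Order.TTheory GRing.Theory Num.Theory.
Import numFieldNormedType.Exports.
Local Open Scope classical_set_scope.
Local Open Scope ring_scope.

(** The identity is a change of variables along the shift. Reading off the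
first letter of a word gives
  M_(n+1)(s,t;w) = m * M_n(phi_(w_1) s, phi_(w_1) t; shift w)
([Mn_recl]), and X2 is stable under the maps phi_i ([X2_phi]), so passing to
the almost sure limit yields
  Minf(s,t;w) = m * Minf(phi_(w_1) s, phi_(w_1) t; shift w)   a.e.
([Minf_recl]); here the shift pulls null sets back to null sets
([ae_left_shift]). Under [mu] the first letter is uniform and independent of
the shifted sequence, which is again distributed as [mu] ([mu_shift]). Hence
integrating m * G (w_1) (shift w) gives the sum over i of the integrals of
G i ([integral_first_letter_shift] for nonnegative G, and
[integral_first_letter_shift_integrable] for integrable G). Multiplying the
recursion for Minf by f (shift w) and integrating is exactly the assertion.

Finiteness is what makes the sum of the integrals meaningful. For a positive
definite kernel J, both |Re J(s,t)| and |Im J(s,t)| are at most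
J(s,s) + J(t,t) ([posdef_cproj_le]). This crude bound replaces the
Cauchy-Schwarz inequality throughout. Applied to the increments
K_(n+1) - K_n, it makes Re K_n(s,t) + u_n(s) + u_n(t) a nondecreasing bounded
sequence, so that K_n(s,t) converges on Xfin ([Kn_cproj_cvg]); it passes to
Kinf, to M_n, and then almost everywhere to Minf ([Minf_cproj_le]), so that
f * Minf(s,t) is dominated by f * (h(s) + h(t)), which is integrable for s, t
in X_f. Finally the nonnegative case of the change of variables, applied to
h, shows that phi_i maps X_(f o shift) into X_f ([Xf_phi]).

If f = f o shift almost everywhere, then the two functions give the same
integrals, hence the same domain and the same kernel. *)

(** * Real and imaginary parts of positive definite kernels *)

(** Limits and integrals of complex quantities are taken on real and imaginary
parts; indexing the two parts by a boolean lets one argument serve both. *)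
Definition cproj (R : realType) (b : bool) (z : R[i]) : R :=
  if b then complex.Re z else complex.Im z.

Section Projections.
Context {R : realType}.
Implicit Types (b : bool) (z : R[i]).

Lemma cprojD b z1 z2 : cproj b (z1 + z2) = cproj b z1 + cproj b z2.
Proof. by case: b z1 z2 => -[a1 a2] [b1 b2]. Qed.

Lemma cprojN b z : cproj b (- z) = - cproj b z.
Proof. by case: b z => -[a1 a2]. Qed.

Lemma cproj_sum b (I : Type) (r : seq I) (P : pred I) (F : I -> R[i]) :
  cproj b (\sum_(i <- r | P i) F i) = \sum_(i <- r | P i) cproj b (F i).
Proof. by apply: (big_morph (cproj b)) => [z1 z2|]; [exact: cprojD|case: b]. Qed.

Lemma cproj_natM b n z : cproj b (n%:R * z) = n%:R * cproj b z.
Proof.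
rewrite mulr_natl mulr_natl; elim: n => [|n IH]; first by case: b.
by rewrite !mulrS cprojD IH.
Qed.

Lemma cproj_inj z1 z2 : (forall b, cproj b z1 = cproj b z2) -> z1 = z2.
Proof.
by case: z1 z2 => [a1 a2] [b1 b2] E; have /= -> := E true; have /= -> := E false.
Qed.

End Projections.

Section PositiveDefinite.
Context {R : realType} {Y : Type}.
Implicit Types J : Y -> Y -> R[i].

(** The quadratic form of J at the coefficients 1 and d. *)
Lemma posdef_two J : posdef J -> forall (s t : Y) (d : R[i]),
  0 <= J s s + d * J s t + d^* * J t s + d^* * d * J t t.
Proof.
move=> Jpd s t d.
have := Jpd 2%N (fun a => if a == ord0 then 1 else d)
  (fun a => if a == ord0 then s else t).
by rewrite !big_ord_recl !big_ord0 /= !(conjc1, rmorph1, mul1r, mulr1, addr0) !addrA.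
Qed.

Lemma posdef_diag_ge0 J : posdef J -> forall s, 0 <= complex.Re (J s s).
Proof.
move=> Jpd s; have := posdef_two Jpd s s 0.
by rewrite !(conjc0, rmorph0, mul0r, addr0) lecE => /andP[].
Qed.

(** Testing the form at d = 1 and d = -1 controls the real part, and at d = i
and d = -i the imaginary part: positivity also says that each of these four
values is real, which ties J(t,s) to the conjugate of J(s,t). The bound
loses a factor 2, which is harmless because it only serves domination. *)
Lemma posdef_cproj_le J : posdef J -> forall b s t,
  `|cproj b (J s t)| <= complex.Re (J s s) + complex.Re (J t t).
Proof.
move=> Jpd b s t.
have Hs := posdef_diag_ge0 Jpd s; have Ht := posdef_diag_ge0 Jpd t.
have := posdef_two Jpd s t 1; have := posdef_two Jpd s t (-1).
have := posdef_two Jpd s t 'i%C; have := posdef_two Jpd s t (- 'i%C).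
move: Hs Ht; case: b => /=;
case: (J s s) (J s t) (J t s) (J t t) => [a1 a2] [b1 b2] [c1 c2] [d1 d2];
rewrite !lecE /=; simpc => /= Hs Ht /andP[/eqP E1 H1] /andP[/eqP E2 H2]
  /andP[/eqP E3 H3] /andP[/eqP E4 H4]; rewrite ler_norml; apply/andP; split; lra.
Qed.

End PositiveDefinite.

(** * The iterated kernels and their limit *)

Section Kernels.
Context {R : realType} {X : Type} {p : nat}.
Variables (phi : 'I_p.+1 -> X -> X) (K : X -> X -> R[i]).

Lemma posdef_pullback (J : X -> X -> R[i]) : posdef J -> posdef (pullback phi J).
Proof.
move=> Jpd n c s; rewrite /pullback.
under eq_bigr => a _ do under eq_bigr => b _ do rewrite mulr_sumr.
under eq_bigr => a _ do rewrite exchange_big.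
by rewrite exchange_big; apply: sumr_ge0 => i _; exact: Jpd.
Qed.

Lemma un_recl n s : un phi K n.+1 s = \sum_(i < p.+1) un phi K n (phi i s).
Proof. exact: (cproj_sum true). Qed.

Hypothesis K_posdef : posdef K.
Hypothesis K_le_LK : kernel_le K (pullback phi K).

Lemma Kn_posdef n : posdef (Kn phi K n).
Proof. by elim: n => [//|n IH]; exact: posdef_pullback. Qed.

Lemma Kn_increment n : kernel_le (Kn phi K n) (Kn phi K n.+1).
Proof.
elim: n => [//|n /posdef_pullback]; rewrite /kernel_le; congr posdef.
by apply/funext => s; apply/funext => t; rewrite /pullback sumrB.
Qed.

Lemma un_ge0 n s : 0 <= un phi K n s.
Proof. exact/posdef_diag_ge0/Kn_posdef. Qed.

Lemma un_nd s : nondecreasing_seq (fun n => un phi K n s).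
Proof.
apply/nondecreasing_seqP => n; rewrite -subr_ge0.
apply: le_trans (posdef_diag_ge0 (Kn_increment n) s) _.
by rewrite -[complex.Re _]/(cproj true _) cprojD cprojN.
Qed.

Lemma un_cvge s : cvgn (fun n => (un phi K n s)%:E).
Proof.
apply: ereal_nondecreasing_is_cvgn => a b ab; rewrite lee_fin; exact: un_nd.
Qed.

Lemma un_le_uinf n s : ((un phi K n s)%:E <= uinf phi K s)%E.
Proof.
apply: lime_ge; first exact: un_cvge.
by exists n => // k /= nk; rewrite lee_fin; exact: un_nd.
Qed.

Lemma uinf_ge0 s : (0 <= uinf phi K s)%E.
Proof. by apply: le_trans (un_le_uinf 0 s); rewrite lee_fin un_ge0. Qed.

(** u_n(phi_i s) is one of the nonnegative terms of u_(n+1)(s). *)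
Lemma uinf_phi_le i s : (uinf phi K (phi i s) <= uinf phi K s)%E.
Proof.
apply: lime_le; first exact: un_cvge.
apply: nearW => n; apply: le_trans (un_le_uinf n.+1 s).
rewrite lee_fin un_recl (bigD1 i) //= lerDl.
by apply: sumr_ge0 => j _; exact: un_ge0.
Qed.

Lemma Xfin_phi i s : Xfin phi K s -> Xfin phi K (phi i s).
Proof. exact: le_lt_trans (uinf_phi_le i s). Qed.

Lemma Xfin_phiw w s : Xfin phi K s -> Xfin phi K (phiw phi w s).
Proof. by elim: w s => [//|i w IH] s ?; apply: IH; exact: Xfin_phi. Qed.

Lemma un_bounded s : Xfin phi K s -> exists M, forall n, un phi K n s <= M.
Proof.
move=> sfin; exists (fine (uinf phi K s)) => n.
rewrite -lee_fin fineK ?un_le_uinf // ge0_fin_numE //; exact: uinf_ge0.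
Qed.

Lemma un_cvg s : Xfin phi K s -> cvgn (fun n => un phi K n s).
Proof.
move=> /un_bounded[M uM]; apply: nondecreasing_is_cvgn; first exact: un_nd.
by exists M => _ [n _ <-]; exact: uM.
Qed.

(** Off the diagonal K_n has no monotonicity, but the increments K_(n+1) - K_n
are positive definite, so adding u_n(s) + u_n(t) compensates any decrease of
the real or imaginary part: v below is nondecreasing and bounded. *)
Lemma Kn_cproj_cvg b s t : Xfin phi K s -> Xfin phi K t ->
  cvgn (fun n => cproj b (Kn phi K n s t)).
Proof.
move=> sfin tfin.
set v := fun n => cproj b (Kn phi K n s t) + (un phi K n s + un phi K n t).
have [M uM] := un_bounded sfin; have [N uN] := un_bounded tfin.
have vcvg : cvgn v.
  apply: nondecreasing_is_cvgn; last first.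
    exists (M + N + (M + N)) => _ [n _ <-].
    apply: lerD; last by apply: lerD.
    apply: le_trans (ler_norm _) _; apply: le_trans (lerD (uM n) (uN n)).
    exact/posdef_cproj_le/Kn_posdef.
  apply/nondecreasing_seqP => n; rewrite -subr_ge0.
  have := posdef_cproj_le (Kn_increment n) b s t.
  rewrite -![complex.Re _]/(cproj true _) !(cprojD, cprojN) ler_norml /v /un.
  by rewrite -![complex.Re _]/(cproj true _) => /andP[H _]; lra.
have -> : (fun n => cproj b (Kn phi K n s t)) =
    (fun n => v n - (un phi K n s + un phi K n t)).
  by apply/funext => n; rewrite /v addrK.
apply: is_cvgB => //; apply: is_cvgD; exact: un_cvg.
Qed.

Lemma Kinf_cproj b s t : cproj b (Kinf phi K s t) =
  limn (fun n => cproj b (Kn phi K n s t)).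
Proof. by case: b. Qed.

Lemma Kinf_cproj_le b s t : Xfin phi K s -> Xfin phi K t ->
  `|cproj b (Kinf phi K s t)| <=
    complex.Re (Kinf phi K s s) + complex.Re (Kinf phi K t t).
Proof.
move=> sfin tfin; rewrite Kinf_cproj /=.
have cst := Kn_cproj_cvg (b := b) sfin tfin.
have cs := un_cvg sfin; have ct := un_cvg tfin.
rewrite -[limn (fun n => complex.Re (Kn phi K n s s))]/(limn (fun n => un phi K n s)).
rewrite -[limn (fun n => complex.Re (Kn phi K n t t))]/(limn (fun n => un phi K n t)).
rewrite -lim_norm // -limD //.
apply: ler_lim; [exact: is_cvg_norm | exact: is_cvgD | apply: nearW => n /=].
exact/posdef_cproj_le/Kn_posdef.
Qed.

(** The words of length n applied to phi_i s are the words of length n.+1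
starting with i applied to s, so the n-th term of B(phi_i s) is at most the
(n.+1)-th term of B(s), whose factor m ^ n.+1 is also larger. *)
Lemma X2_phi i s : X2 phi K s -> X2 phi K (phi i s).
Proof.
move=> [sfin sB]; split; first exact: Xfin_phi.
apply: le_lt_trans sB; apply: ge_ereal_sup => _ [n _ <-].
apply: (@le_trans _ _ ((p.+1%:R ^+ n.+1)%:E *
  \sum_(w : n.+1.-tuple 'I_p.+1) uinf phi K (phiw phi w s) ^+ 2)%E); last first.
  by apply: ereal_sup_ubound; exists n.+1.
apply: lee_pmul.
- by rewrite lee_fin exprn_ge0.
- by apply: sume_ge0 => w _; rewrite expe_ge0 // uinf_ge0.
- by rewrite lee_fin ler_weXn2l // ler1n.
pose F (w : seq 'I_p.+1) := (uinf phi K (phiw phi w s) ^+ 2)%E.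
have F0 w : (0 <= F w)%E by rewrite expe_ge0 // uinf_ge0.
apply: (@le_trans _ _ (\sum_(w : n.+1.-tuple 'I_p.+1 | thead w == i) F w)%E).
  rewrite (reindex_onto (fun w : n.-tuple _ => [tuple of i :: w])
    (fun w => [tuple of behead w])) /=; last first.
    by move=> w /eqP <-; rewrite [RHS]tuple_eta; exact: val_inj.
  rewrite le_eqVlt; apply/orP; left; apply/eqP; apply: eq_big => //= w.
  by rewrite theadE eqxx /=; apply/esym/eqP/val_inj.
rewrite [leRHS](bigID (fun w => thead w == i)) /= leeDl //.
by apply: sume_ge0 => w _; exact: F0.
Qed.

End Kernels.

(** * The shift under the uniform product measure *)

Section CoinTossing.
Context {R : realType} {p : nat}.
Implicit Types (i : 'I_p.+1) (k : nat).

Lemma measurable_coord k (A : set 'I_p.+1) :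
  measurable [set w : Omega p | A (w k)].
Proof.
rewrite (_ : mkset _ = \bigcup_(i in A) [set w : Omega p | w k = i]); last first.
  by apply/seteqP; split => [w Aw|w [i Ai /= ->]] //; exists (w k).
apply: fin_bigcup_measurable; first exact: finite_finset.
by move=> i _; apply: sub_sigma_algebra; exists k, i.
Qed.

Lemma measurable_left_shift : measurable_fun setT (@left_shift p).
Proof.
apply: (@measurability _ _ (Omega p) (Omega p) setT (@left_shift p) (@coord_events p)) => //.
move=> _ [_ [k [i ->]] <-]; rewrite setTI.
exact: (measurable_coord k.+1 [set i]).
Qed.

Definition cylinder (A : nat -> set 'I_p.+1) : set (Omega p) :=
  [set w | forall k, A k (w k)].

(** Unlike the coordinate events, the cylinders with finitely many constrained
coordinates form a pi-system. The bound n need not be sharp, so cylinders of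
different lengths are intersected coordinate by coordinate. *)
Definition cylinders : set (set (Omega p)) :=
  [set B | exists (A : nat -> set 'I_p.+1) (n : nat),
    (forall k, (n <= k)%N -> A k = setT) /\ B = cylinder A].

Lemma cylinderE (A : nat -> set 'I_p.+1) n : (forall k, (n <= k)%N -> A k = setT) ->
  cylinder A = \bigcap_(k in [set` iota 0 n]) [set w : Omega p | A k (w k)].
Proof.
move=> An; apply/seteqP; split => [w Aw k _|w Aw k]; first exact: (Aw k).
have [nk|kn] := leqP n k; first by rewrite An.
by apply: (Aw k); rewrite /= mem_iota.
Qed.

Lemma cylinders_setI : setI_closed cylinders.
Proof.
move=> _ _ [A [n [An ->]]] [A' [n' [An' ->]]].
exists (fun k => A k `&` A' k), (maxn n n'); split => [k|].
  by rewrite geq_max => /andP[? ?]; rewrite An // An' // setTI.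
by apply/seteqP; split => [w [? ?] k|w H]; split => // k; have [] := H k.
Qed.

Lemma cylindersT : cylinders setT.
Proof. by exists (fun=> setT), 0%N; split => //; apply/seteqP; split. Qed.

Lemma measurable_cylinder : cylinders `<=` measurable.
Proof.
move=> _ [A [n [An ->]]]; rewrite (cylinderE An).
apply: fin_bigcap_measurable => [|k _]; first exact: finite_seq.
exact: measurable_coord.
Qed.

Lemma cylinders_generate :
  @measurable _ (Omega p) = <<s cylinders >>.
Proof.
apply/seteqP; split; last first.
  by apply: smallest_sub; [exact: sigma_algebra_measurable|exact: measurable_cylinder].
apply: smallest_sub; first exact: smallest_sigma_algebra.
move=> _ [k [i ->]]; apply: sub_sigma_algebra.
exists (fun j => if j == k then [set i] else setT), k.+1; split.
  by move=> j kj; rewrite gtn_eqF.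
apply/seteqP; split => [w /= <- j|w /(_ k)]; last by rewrite eqxx.
by case: eqVneq => [->|].
Qed.

Variable mu : probability (Omega p) R.
Hypothesis mu_iid : iid_uniform mu.

(** The value does not depend on k, so shifting all the constraints of a
cylinder by one coordinate does not change its measure. *)
Lemma mu_coord k (A : set 'I_p.+1) :
  mu [set w | A (w k)] = (\sum_(i \in A) (p.+1%:R^-1 : R)%:E)%E.
Proof.
rewrite (_ : mkset _ = \bigcup_(i in A) [set w : Omega p | w k = i]); last first.
  by apply/seteqP; split => [w Aw|w [i Ai /= ->]] //; exists (w k).
rewrite measure_fin_bigcup //.
- by apply: eq_fsbigr => i _; case: mu_iid => + _; apply.
- exact: finite_finset.
- by move=> i j _ _ [w [/= <- <-]].
- by move=> i _; exact: (measurable_coord k [set i]).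
Qed.

(** The event on the left is again a cylinder, with [set i] inserted in front
of the constraints, so both sides are products over coordinates. *)
Lemma mu_shift_cylinder i B : cylinders B ->
  mu (@left_shift p @^-1` B `&` [set w | w 0%N = i]) = ((p.+1%:R^-1)%:E * mu B)%E.
Proof.
move=> [A [n [An ->]]]; case: mu_iid => mu1 muI.
pose A' k := if k is k'.+1 then A k' else [set i].
have A'n k : (n.+1 <= k)%N -> A' k = setT by case: k => // k; exact: An.
have -> : @left_shift p @^-1` cylinder A `&` [set w | w 0%N = i] = cylinder A'.
  apply/seteqP; split => [w [Aw wi] k|w Aw].
    by case: k => [|k]; [exact: wi|exact: (Aw k)].
  by split => [k|]; [exact: (Aw k.+1)|exact: (Aw 0%N)].
rewrite (cylinderE An) (cylinderE A'n) !muI ?iota_uniq //.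
rewrite /= big_cons (mu1 0%N i); congr (_ * _)%E.
rewrite -[1%N]addn0 iotaDl big_map; apply: eq_bigr => k _.
by rewrite /A' /= !mu_coord.
Qed.

Let mC i : measurable [set w : Omega p | w 0%N = i] := measurable_coord 0 [set i].

(** The first letter is uniform and independent of the shifted sequence, whose
law is [mu]: the two sides are finite measures in B that agree on the
pi-system of cylinders. *)
Lemma mu_shift i B : measurable B ->
  mu (@left_shift p @^-1` B `&` [set w | w 0%N = i]) = ((p.+1%:R^-1)%:E * mu B)%E.
Proof.
have r0 : 0 <= p.+1%:R^-1 :> R by rewrite invr_ge0.
pose nu : {measure set (Omega p) -> \bar R} := mrestr mu (mC i).
pose pu : {measure set (Omega p) -> \bar R} := pushforward nu (@left_shift p).
pose mum : {measure set (Omega p) -> \bar R} := mscale (NngNum r0) mu.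
move=> mB; rewrite -[LHS]/(pu measurable_left_shift B) -[RHS]/(mum B).
apply: (@measure_unique _ R (Omega p) cylinders (fun=> setT) cylinders_generate
  cylinders_setI (fun=> cylindersT) _ (pu measurable_left_shift) mum) => //.
- by apply/seteqP; split => // w _; exists 0%N.
- by move=> C CC; exact: mu_shift_cylinder.
- move=> k; rewrite /pu /nu /= /pushforward /mrestr preimage_setT setTI.
  by rewrite -ge0_fin_numE // fin_num_measure.
Qed.

Lemma mu_first_letter B : measurable B ->
  mu B = (\sum_(i < p.+1) mu (B `&` [set w | w 0%N = i]))%E.
Proof.
move=> mB; rewrite -measure_bigsetU_ord //.
- congr (mu _); apply/seteqP; split => [w Bw|w].
    rewrite -bigcup_mkord_ord; exists (w 0%N : nat) => /=; first exact: ltn_ord.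
    by rewrite inord_val.
  by rewrite -bigcup_mkord_ord => -[i _ []].
- by move=> i; apply: measurableI => //; exact: mC.
- by move=> i j _ _ [w [[_ /= <-] [_ /= <-]]].
Qed.

Lemma ae_left_shift (P : set (Omega p)) :
  {ae mu, forall w, P w} -> {ae mu, forall w, P (left_shift w)}.
Proof.
move=> [N [mN N0 PN]]; exists (@left_shift p @^-1` N); split.
- by rewrite -[X in measurable X]setTI; exact: measurable_left_shift.
- rewrite mu_first_letter; last first.
    by rewrite -[X in measurable X]setTI; exact: measurable_left_shift.
  by rewrite big1 // => i _; rewrite mu_shift // N0 mule0.
- by move=> w /= Pw; exact: PN.
Qed.

Lemma measurable_first_letter_shift d (U : measurableType d)
    (G : 'I_p.+1 -> Omega p -> U) : (forall i, measurable_fun setT (G i)) ->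
  measurable_fun setT (fun w : Omega p => G (w 0%N) (left_shift w)).
Proof.
move=> mG _ B mB; rewrite setTI.
rewrite (_ : _ @^-1` B = \bigcup_(i in setT)
  ((@left_shift p @^-1` (G i @^-1` B)) `&` [set w | w 0%N = i])); last first.
  by apply/seteqP; split => [w Bw|w [i _ [/= + ->]]] //; exists (w 0%N).
apply: fin_bigcup_measurable => [|i _]; first exact: finite_finset.
apply: measurableI; last exact: mC.
rewrite -[X in measurable X]setTI; apply: measurable_left_shift => //.
by rewrite -[X in measurable X]setTI; exact: mG.
Qed.

(** Split [mu] into its restrictions to the events that the first letter is i.
Under the i-th restriction, w 0 is almost everywhere i and the shift has law
mu / m by [mu_shift]; the factor m cancels. *)
Lemma integral_first_letter_shift (G : 'I_p.+1 -> Omega p -> \bar R) :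
  (forall i, measurable_fun setT (G i)) -> (forall i w, 0 <= G i w)%E ->
  (\int[mu]_w ((p.+1%:R : R)%:E * G (w 0%N) (left_shift w)) =
   \sum_(i < p.+1) \int[mu]_w G i w)%E.
Proof.
move=> mG G0.
have r0 : 0 <= p.+1%:R^-1 :> R by rewrite invr_ge0.
have mF := measurable_first_letter_shift mG.
pose nu i : {measure set (Omega p) -> \bar R} := mrestr mu (mC i).
pose pu i : {measure set (Omega p) -> \bar R} :=
  pushforward (nu i) (@left_shift p).
pose mum : {measure set (Omega p) -> \bar R} := mscale (NngNum r0) mu.
rewrite ge0_integralZl //.
(* [msum] is indexed by nat, whence the detour through [inord]. *)
have -> : (\int[mu]_w G (w 0%N) (left_shift w) =
    \int[msum (fun k => nu (inord k)) p.+1]_w G (w 0%N) (left_shift w))%E.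
  apply: eq_measure_integral => B mB _.
  apply: etrans (mu_first_letter mB) _; rewrite /msum.
  by apply: eq_bigr => i _; rewrite /nu /= inord_val.
rewrite ge0_integral_measure_sum //.
rewrite ge0_sume_distrr; last by move=> i _; exact: integral_ge0.
apply: eq_bigr => i _; rewrite inord_val.
transitivity ((p.+1%:R : R)%:E * \int[nu i]_w (G i \o @left_shift p) w)%E.
  congr (_ * _)%E; apply: ge0_ae_eq_integral => //.
    by apply: measurableT_comp => //; exact: measurable_left_shift.
  - by move=> w _; exact: G0.
  exists (~` [set w | w 0%N = i]); split.
  - by apply: measurableC; exact: mC.
  - by rewrite /nu /= /mrestr setICl measure0.
  - by move=> w /= H wi; apply: H => _; rewrite wi.
have <- : (\int[pushforward (nu i) (@left_shift p)]_w G i w =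
    \int[nu i]_w (G i \o @left_shift p) w)%E.
  by rewrite ge0_integral_pushforward //; exact: measurable_left_shift.
rewrite (@eq_measure_integral _ _ _ _ mum (pu measurable_left_shift i)); last first.
  by move=> B mB _; exact: mu_shift.
rewrite ge0_integral_mscale // muleA -EFinM mulfV ?mul1e //.
Qed.

Lemma integral_first_letter_shift_integrable (G : 'I_p.+1 -> Omega p -> \bar R) :
  (forall i, mu.-integrable setT (G i)) ->
  (\int[mu]_w ((p.+1%:R : R)%:E * G (w 0%N) (left_shift w)) =
   \sum_(i < p.+1) \int[mu]_w G i w)%E.
Proof.
move=> iG; have mG i := measurable_int mu (iG i).
rewrite integralE; under eq_bigr => i _ do rewrite integralE.
rewrite !ge0_funeposM // !ge0_funenegM //.
rewrite big_split fin_num_sumeN /=; last by move=> i _; exact: integrable_neg_fin_num.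
congr (_ - _)%E.
- rewrite -(integral_first_letter_shift (G := fun i => (G i)^\+%E)) //.
    by apply: eq_integral => w _; rewrite !funeposE.
  by move=> i; exact: measurable_funepos.
- rewrite -(integral_first_letter_shift (G := fun i => (G i)^\-%E)) //.
    by apply: eq_integral => w _; rewrite !funenegE.
  by move=> i; exact: measurable_funeneg.
Qed.

End CoinTossing.

(** * Almost sure behaviour of the limit of M_n *)

Section MartingaleLimit.
Context {R : realType} {X : Type} {p : nat}.
Variables (phi : 'I_p.+1 -> X -> X) (K : X -> X -> R[i]).
Hypothesis K_posdef : posdef K.
Hypothesis K_le_LK : kernel_le K (pullback phi K).
Variable mu : probability (Omega p) R.
Hypothesis mu_iid : iid_uniform mu.
Variable Minf : X -> X -> Omega p -> R[i].
Hypothesis Minf_lim : is_limit_version phi K mu Minf.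

Lemma Mn_recl n s t w : Mn phi K n.+1 s t w =
  p.+1%:R * Mn phi K n (phi (w 0%N) s) (phi (w 0%N) t) (left_shift w).
Proof.
rewrite /Mn exprS -mulrA; congr (_ * (_ * _)).
rewrite /wprefix /mkseq -[iota 0 n.+1]/(0%N :: iota 1 n) /= -[1%N]addn0 iotaDl.
by rewrite -map_comp.
Qed.

Lemma Mn_cproj b n s t w : cproj b (Mn phi K n s t w) = p.+1%:R ^+ n *
  cproj b (Kinf phi K (phiw phi (wprefix w n) s) (phiw phi (wprefix w n) t)).
Proof. by rewrite /Mn -!natrX cproj_natM. Qed.

Lemma Mn_cproj_le b n s t w : Xfin phi K s -> Xfin phi K t ->
  `|cproj b (Mn phi K n s t w)| <=
    complex.Re (Mn phi K n s s w) + complex.Re (Mn phi K n t t w).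
Proof.
move=> sfin tfin; rewrite -![complex.Re _]/(cproj true _) !Mn_cproj -mulrDr.
rewrite normrM ger0_norm ?exprn_ge0 // ler_wpM2l ?exprn_ge0 //.
by apply: Kinf_cproj_le => //; exact: Xfin_phiw.
Qed.

Lemma Minf_ae b s t : X2 phi K s -> X2 phi K t ->
  {ae mu, forall w, (fun n => cproj b (Mn phi K n s t w)) @ \oo -->
                    cproj b (Minf s t w)}.
Proof.
move=> s2 t2; have [H _] := Minf_lim; have [_ _ _ _] := H s t s2 t2.
by apply: filterS => w [? ?]; case: b.
Qed.

Lemma measurable_Minf b s t : X2 phi K s -> X2 phi K t ->
  measurable_fun setT (fun w => cproj b (Minf s t w)).
Proof.
by move=> s2 t2; have [H _] := Minf_lim; have [? ? _ _ _] := H s t s2 t2; case: b.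
Qed.

Lemma hdiag_ge0 s w : X2 phi K s -> 0 <= hdiag Minf s w.
Proof. by move=> s2; have [_ /(_ s w s2)] := Minf_lim; rewrite lecE => /andP[]. Qed.

Lemma Minf_cproj_le b s t : X2 phi K s -> X2 phi K t ->
  {ae mu, forall w, `|cproj b (Minf s t w)| <= hdiag Minf s w + hdiag Minf t w}.
Proof.
move=> s2 t2; have [sfin _] := s2; have [tfin _] := t2.
have A := Minf_ae b s2 t2; have B := Minf_ae true s2 s2.
have C := Minf_ae true t2 t2.
apply: filterS3 A B C => w Aw Bw Cw.
apply: (ler_cvg_to (cvg_norm Aw) (cvgD Bw Cw)); apply: nearW => n.
exact: Mn_cproj_le.
Qed.

(** The recursion of M_n passes to the limit wherever the sequences started at
the points phi_i s, phi_i t all converge along shift w. There are finitely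
many i, so taking all of them at once avoids conditioning on the letter w 0. *)
Lemma Minf_recl b s t : X2 phi K s -> X2 phi K t ->
  {ae mu, forall w, cproj b (Minf s t w) = p.+1%:R *
     cproj b (Minf (phi (w 0%N) s) (phi (w 0%N) t) (left_shift w))}.
Proof.
move=> s2 t2.
have A := Minf_ae b s2 t2.
have B : {ae mu, forall w, forall i : 'I_p.+1,
    (fun n => cproj b (Mn phi K n (phi i s) (phi i t) w)) @ \oo -->
    cproj b (Minf (phi i s) (phi i t) w)}.
  by apply: filter_forall => i; apply: Minf_ae; exact: X2_phi.
apply: filterS2 (ae_left_shift mu_iid B) A => w /(_ (w 0%N)) Bw Aw.
have E : (fun n => cproj b (Mn phi K n.+1 s t w)) @ \oo --> p.+1%:R *
    cproj b (Minf (phi (w 0%N) s) (phi (w 0%N) t) (left_shift w)).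
  under eq_fun do rewrite Mn_recl cproj_natM.
  exact: cvgM (cvg_cst _) Bw.
by move: Aw; rewrite -cvg_shiftS => Aw; exact: (cvg_unique _ Aw E).
Qed.

End MartingaleLimit.

(** * Invariance of the kernels J_f *)

Section ShiftedKernel.
Context {R : realType} {X : Type} {p : nat}.
Variables (phi : 'I_p.+1 -> X -> X) (K : X -> X -> R[i]).
Hypothesis K_posdef : posdef K.
Hypothesis K_le_LK : kernel_le K (pullback phi K).
Variable mu : probability (Omega p) R.
Hypothesis mu_iid : iid_uniform mu.
Variable Minf : X -> X -> Omega p -> R[i].
Hypothesis Minf_lim : is_limit_version phi K mu Minf.

Definition Jf_integrand (f : Omega p -> \bar R) b s t w : \bar R :=
  (f w * (cproj b (Minf s t w))%:E)%E.

Lemma cproj_Jf b f s t :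
  cproj b (Jf mu Minf f s t) = fine (\int[mu]_w Jf_integrand f b s t w).
Proof. by case: b. Qed.

Variable f : Omega p -> \bar R.
Hypothesis f_meas : measurable_fun [set: Omega p] f.
Hypothesis f_ge0 : forall w, (0 <= f w)%E.

Lemma measurable_Jf_integrand b s t : X2 phi K s -> X2 phi K t ->
  measurable_fun setT (Jf_integrand f b s t).
Proof.
move=> s2 t2; apply: emeasurable_funM => //.
by apply/measurable_EFinP; exact: (measurable_Minf Minf_lim).
Qed.

Lemma Jf_integrand_diag_ge0 s w : X2 phi K s -> (0 <= Jf_integrand f true s s w)%E.
Proof. by move=> s2; rewrite mule_ge0 // lee_fin (hdiag_ge0 Minf_lim). Qed.

(** Dominated by f * (h(s) + h(t)), through [Minf_cproj_le]. *)
Lemma Jf_integrand_integrable b s t :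
  Xf phi K mu Minf f s -> Xf phi K mu Minf f t ->
  mu.-integrable setT (Jf_integrand f b s t).
Proof.
move=> [s2 fs] [t2 ft]; apply/integrableP; split; first exact: measurable_Jf_integrand.
apply: (@le_lt_trans _ _
  (\int[mu]_w (Jf_integrand f true s s w + Jf_integrand f true t t w))%E); last first.
  rewrite ge0_integralD //; first exact: lte_add_pinfty.
  - by move=> w _; exact: Jf_integrand_diag_ge0.
  - exact: measurable_Jf_integrand.
  - by move=> w _; exact: Jf_integrand_diag_ge0.
  - exact: measurable_Jf_integrand.
apply: ae_ge0_le_integral => //.
- by apply: measurableT_comp => //; exact: measurable_Jf_integrand.
- by move=> w _; rewrite adde_ge0 // Jf_integrand_diag_ge0.
- by apply: emeasurable_funD; exact: measurable_Jf_integrand.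
apply: filterS (Minf_cproj_le K_posdef K_le_LK Minf_lim b s2 t2) => w le_h _.
rewrite /Jf_integrand abseM gee0_abs // -ge0_muleDr ?lee_fin ?(hdiag_ge0 Minf_lim) //.
by rewrite lee_wpmul2l // lee_fin.
Qed.

Lemma integral_Jf_integrand_shift b s t : X2 phi K s -> X2 phi K t ->
  (\int[mu]_w Jf_integrand (f \o @left_shift p) b s t w =
   \int[mu]_w ((p.+1%:R : R)%:E *
     Jf_integrand f b (phi (w 0%N) s) (phi (w 0%N) t) (left_shift w)))%E.
Proof.
move=> s2 t2; have mphi i := measurable_Jf_integrand b
  (X2_phi K_posdef K_le_LK i s2) (X2_phi K_posdef K_le_LK i t2).
apply: ae_eq_integral => //.
- apply: emeasurable_funM.
    by apply: measurableT_comp => //; exact: measurable_left_shift.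
  by apply/measurable_EFinP; exact: (measurable_Minf Minf_lim).
- apply: emeasurable_funM => //.
  exact: (measurable_first_letter_shift mphi).
apply: filterS (Minf_recl K_posdef K_le_LK mu_iid Minf_lim b s2 t2) => w E _.
by rewrite /Jf_integrand /= E EFinM muleCA.
Qed.

(** The integral of (f o shift) * h(s) is the sum over i of the nonnegative
integrals of f * h(phi_i s), hence bounds each of them. *)
Lemma Xf_phi i s : Xf phi K mu Minf (f \o @left_shift p) s ->
  Xf phi K mu Minf f (phi i s).
Proof.
move=> [s2 fs]; split; first exact: X2_phi.
apply: le_lt_trans fs.
rewrite -[leRHS]/(\int[mu]_w Jf_integrand (f \o @left_shift p) true s s w)%E.
rewrite integral_Jf_integrand_shift //.
rewrite (@integral_first_letter_shift _ _ _ mu_iid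
  (fun j => Jf_integrand f true (phi j s) (phi j s))).
- rewrite (bigD1 i) //= leeDl // sume_ge0 // => j _.
  by apply: integral_ge0 => w _; apply: Jf_integrand_diag_ge0; exact: X2_phi.
- by move=> j; apply: measurable_Jf_integrand; exact: X2_phi.
- by move=> j w; apply: Jf_integrand_diag_ge0; exact: X2_phi.
Qed.

Lemma pullback_Jf_shift s t :
  Xf phi K mu Minf (f \o @left_shift p) s ->
  Xf phi K mu Minf (f \o @left_shift p) t ->
  pullback phi (Jf mu Minf f) s t = Jf mu Minf (f \o @left_shift p) s t.
Proof.
move=> fs ft; apply: cproj_inj => b; rewrite cproj_Jf cproj_sum.
have [s2 _] := fs; have [t2 _] := ft.
have int i : mu.-integrable setT (Jf_integrand f b (phi i s) (phi i t)).
  by apply: Jf_integrand_integrable; exact: Xf_phi.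
rewrite integral_Jf_integrand_shift //.
rewrite (@integral_first_letter_shift_integrable _ _ _ mu_iid
  (fun j => Jf_integrand f b (phi j s) (phi j t))) //.
(* J_f takes [fine] of each integral, which is additive on finite values only. *)
rewrite -sum_fine; last by move=> i _; exact: integrable_fin_num.
by apply: eq_bigr => i _; rewrite cproj_Jf.
Qed.

Lemma integral_Jf_integrand_ae_eq b g s t : measurable_fun [set: Omega p] g ->
  {ae mu, forall w, f w = g w} -> X2 phi K s -> X2 phi K t ->
  (\int[mu]_w Jf_integrand f b s t w = \int[mu]_w Jf_integrand g b s t w)%E.
Proof.
move=> g_meas fg s2 t2; apply: ae_eq_integral => //.
- exact: measurable_Jf_integrand.
- apply: emeasurable_funM => //.
  by apply/measurable_EFinP; exact: (measurable_Minf Minf_lim).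
- by apply: filterS fg => w E _; rewrite /Jf_integrand E.
Qed.

End ShiftedKernel.

Theorem theorem7p3 (R : realType) (X : Type) (p : nat)
  (phi : 'I_p.+1 -> X -> X) (K : X -> X -> R[i])
  (K_posdef : posdef K)
  (K_le_LK : kernel_le K (pullback phi K))
  (mu : probability (Omega p) R) (mu_iid : iid_uniform mu)
  (Minf : X -> X -> Omega p -> R[i])
  (Minf_lim : is_limit_version phi K mu Minf)
  (f : Omega p -> \bar R)
  (f_meas : measurable_fun [set: Omega p] f)
  (f_ge0 : forall w : Omega p, (0 <= f w)%E) :
  (forall s t : X,
     Xf phi K mu Minf (f \o @left_shift p) s ->
     Xf phi K mu Minf (f \o @left_shift p) t ->
     pullback phi (Jf mu Minf f) s t = Jf mu Minf (f \o @left_shift p) s t) /\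
  ({ae mu, forall w, f w = (f \o @left_shift p) w} ->
   forall s t : X,
     Xf phi K mu Minf f s -> Xf phi K mu Minf f t ->
     pullback phi (Jf mu Minf f) s t = Jf mu Minf f s t).
Proof.
split=> [s t|f_inv s t fs ft]; first exact: pullback_Jf_shift.
have fsh_meas : measurable_fun [set: Omega p] (f \o @left_shift p).
  by apply: measurableT_comp => //; exact: measurable_left_shift.
have int_eq b x y : X2 phi K x -> X2 phi K y -> _ :=
  integral_Jf_integrand_ae_eq Minf_lim f_meas b fsh_meas f_inv.
have Xf_sub x : Xf phi K mu Minf f x -> Xf phi K mu Minf (f \o @left_shift p) x.
  by move=> [x2 fx]; split => //; rewrite -(int_eq true).
rewrite (pullback_Jf_shift K_posdef K_le_LK mu_iid Minf_lim f_meas f_ge0);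
  try exact: Xf_sub.
have [s2 _] := fs; have [t2 _] := ft.
by apply: cproj_inj => b; rewrite !cproj_Jf int_eq.
Qed.
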